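(* For the Lagrangian bidisk $\mathbf{P}_L=\{(x_1,x_2,y_1,y_2)\in\mathbb{R}^4: x_1^2+x_2^2\le 1,\ y_1^2+y_2^2\le 1\}$, the identity matrix is an isolated local minimum of the function $\mathrm{Sp}(4)\to\mathbb{R}$ defined by $P\mapsto\mathrm{M}(P\mathbf{P}_L)$. Moreover, $\mathbf{P}_L$ is not equal to $QK$ for any toric convex body $K$ and any matrix $Q\in\mathrm{U}(2)$.
   Context: For a bounded subset $X\subset\mathbb{R}^{d}$, the support function is $h_X(u)=\sup_{k\in X}\langle k,u\rangle$ and the mean width is $\mathrm{M}(X)=\int_{S^{d-1}}(h_X(u)+h_X(-u))\,d\sigma$, where $\sigma$ is the rotationally invariant probability measure on the unit sphere $S^{d-1}\subset\mathbb{R}^d$. $\mathrm{Sp}(4)$ is the group of real symplectic $4\times 4$ matrices for the standard symplectic form on $\mathbb{R}^{4}$ pairing $x_i$ with $y_i$, and $\mathrm{U}(2)=\mathrm{Sp}(4)\cap\mathrm{O}(4)$. With $z_j=x_j+iy_j$, a subset of $\mathbb{R}^{4}=\mathbb{C}^2$ is toric if it is invariant under $(\theta_1,\theta_2)\cdot(z_1,z_2)=(e^{i\theta_1}z_1,e^{i\theta_2}z_2)$ for all $\theta_1,\theta_2$. A toric convex body is a convex body (compact convex set with nonempty interior) in $\mathbb{R}^4$ that is toric.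
   Formalization: ''Isolated'' is taken modulo left multiplication by U(2): the identity is a local minimum and every local minimum near it lies in U(2). Literal isolation in Sp(4) fails, since M(UP_L)=M(P_L) for all U in U(2). *)

(* Defs.v *)
From HB Require Import structures.
From mathcomp Require Import all_boot all_order all_algebra.
From mathcomp Require Import all_classical all_reals all_analysis.

Set Implicit Arguments.
Unset Strict Implicit.
Unset Printing Implicit Defensive.

Import Order.TTheory GRing.Theory Num.Theory.
Import numFieldNormedType.Exports.

Local Open Scope classical_set_scope.
Local Open Scope ring_scope.

(** Mean width in R^d.  Matrices carry the max norm in the library, so the
    Euclidean structure is written through [dotp]. *)

Definition dotp (R : realType) (d : nat) (u v : 'cV[R]_d) : R :=
  \sum_(i < d) u i 0 * v i 0.

Definition sphere (R : realType) (d : nat) : set 'cV[R]_d :=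
  [set u | dotp u u = 1].

Definition orthogonal_mx (R : realType) (d : nat) : set 'M[R]_d :=
  [set Q | Q^T *m Q = 1%:M].

Definition rotation_mx (R : realType) (d : nat) : set 'M[R]_d :=
  [set Q | orthogonal_mx Q /\ \det Q = 1].

Definition image_mx (R : realType) (d : nat) (P : 'M[R]_d) (X : set 'cV[R]_d) :
  set 'cV[R]_d := [set P *m v | v in X].

(** R^d with its Borel sigma-algebra. *)
Definition borel_space (R : realType) (d : nat) : measurableType _ :=
  g_sigma_algebraType (@open 'cV[R]_d).

(** The rotations act transitively on the sphere for d >= 2, so exactly one
    probability measure satisfies this: the invariant measure of the sphere,
    seen as a measure on R^d concentrated on the sphere. *)
Definition rotation_invariant_on_sphere (R : realType) (d : nat)
    (sigma : probability (borel_space R d) R) : Prop :=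
  sigma (@sphere R d) = 1%E /\
  forall Q : 'M[R]_d, rotation_mx Q ->
  forall A : set (borel_space R d), measurable A ->
    sigma (image_mx Q A) = sigma A.

(** [sup] is the real supremum; it is the intended value since the sets to
    which [support_fun] is applied are bounded and nonempty. *)
Definition support_fun (R : realType) (d : nat) (X : set 'cV[R]_d)
    (u : 'cV[R]_d) : R :=
  sup [set dotp k u | k in X].

Definition mean_width (R : realType) (d : nat)
    (sigma : probability (borel_space R d) R) (X : set 'cV[R]_d) : R :=
  \int[sigma]_(u in @sphere R d) (support_fun X u + support_fun X (- u)).

(** R^4, with coordinates ordered (x_1, x_2, y_1, y_2): the upper block of a
    vector of R^(2+2) is x, the lower block is y, and z_j = x_j + i y_j. *)

Definition omega_mx (R : realType) : 'M[R]_(2 + 2) :=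
  block_mx 0 1%:M (- 1%:M) 0.

Definition Sp4 (R : realType) : set 'M[R]_(2 + 2) :=
  [set P | P^T *m omega_mx R *m P = omega_mx R].

Definition U2 (R : realType) : set 'M[R]_(2 + 2) :=
  @Sp4 R `&` @orthogonal_mx R (2 + 2).

Definition lagrangian_bidisk (R : realType) : set 'cV[R]_(2 + 2) :=
  [set v | let x := usubmx v in let y := dsubmx v in
    x 0 0 ^+ 2 + x 1 0 ^+ 2 <= 1 /\ y 0 0 ^+ 2 + y 1 0 ^+ 2 <= 1].

(** (z_1, z_2) |-> (e^(i theta_1) z_1, e^(i theta_2) z_2). *)
Definition torus_act (R : realType) (theta : 'I_2 -> R) (v : 'cV[R]_(2 + 2)) :
    'cV[R]_(2 + 2) :=
  let x := usubmx v in let y := dsubmx v in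
  col_mx (\col_j (cos (theta j) * x j 0 - sin (theta j) * y j 0))
         (\col_j (sin (theta j) * x j 0 + cos (theta j) * y j 0)).

Definition toric (R : realType) (X : set 'cV[R]_(2 + 2)) : Prop :=
  forall theta : 'I_2 -> R, [set torus_act theta v | v in X] = X.

Definition convex_body (R : realType) (d : nat) (K : set 'cV[R]_d) : Prop :=
  [/\ compact K, convex_set K & K° !=set0].

(** Local minima on [A] with its subspace topology. *)
Definition local_min_on (R : realType) (T : topologicalType) (A : set T)
    (F : T -> R) (p : T) : Prop :=
  A p /\ \forall q \near within A (nbhs p), F p <= F q.

(** For a matrix group [G] acting on [A] by left multiplication and leaving
    [F] invariant, no point of a nontrivial connected group can be isolated
    among the minima of [F].  Isolation is therefore that of the class of [P]
    in G \ A: every local minimum of [F] close to [P] lies in the orbit of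
    [P].  This is stronger than F P < F Q for Q in A close to P and
    outside the orbit of [P], as a nearby Q with F Q = F P would be another
    local minimum. *)
Definition isolated_local_min_mod (R : realType) (n : nat)
    (G A : set 'M[R]_n) (F : 'M[R]_n -> R) (P : 'M[R]_n) : Prop :=
  local_min_on A F P /\
  \forall Q \near P,
    local_min_on A F Q -> exists2 U : 'M[R]_n, G U & Q = U *m P.

(* Main.v *)
Require Import Defs.
From mathcomp Require Import all_boot all_order all_algebra.
From mathcomp Require Import all_classical all_reals all_analysis.
From mathcomp Require Import finmap measurable_realfun ring lra.

Import Order.TTheory GRing.Theory Num.Theory.
Import numFieldNormedType.Exports.

Local Open Scope classical_set_scope.
Local Open Scope ring_scope.

Set Implicit Arguments.
Unset Strict Implicit.
Unset Printing Implicit Defensive.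

(** Write [w P] for the average over the sphere of [|x| + |y|] where
    [(x, y) = P^T u].  Since [|x| + |y|] is the support function of the
    Lagrangian bidisk, the mean width of its image under [P] is [2 * w P], and
    [w] is invariant under [P |-> U P k] for [U] in U(2) and [k = diag (W, W)]
    with [W] in O(2).

    Modulo these symmetries a symplectic matrix has a normal form
    [[D, D S; 0, D^-1]] with [D] diagonal positive and [S] symmetric
    ([normal_form]): rotate the first two columns inside their span until they
    are orthogonal, normalise them, and complete them to a unitary frame with
    the complex structure; the symplectic relations fix the rest.  On normal
    forms
      [w = E |D x| + E |S D x + D^-1 y|],
    and two convexity arguments apply.
    - In [S], for fixed [D], this is convex and even (the rotation
      [(x, y) |-> (- x, y)] preserves the average), with a strict minimum at
      [S = 0].  So if [S <> 0], moving [S] to [t S] with [t < 1] decreases [w].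
    - For [S = 0] it is [E |D x| + E |D^-1 x|], which is convex in the entries
      of [D] because [1 / d] is, and the pointwise inequality
      [|x|^2 = <D x, D^-1 x> <= |D x| |D^-1 x|] shows that its only minimum is
      at [D = 1].  So if [D <> 1], moving [D] linearly towards 1 decreases [w].
    Hence the identity is a minimum on the whole of Sp(4)
    ([bidisk_width_min]), and every local minimum of [w] on Sp(4) has
    [S = 0] and [D = 1], that is, lies in U(2) ([local_min_bidisk_width]).
    Strictness of the inequalities between averages comes from the invariant
    measure charging every nonempty open set of the sphere ([lt_average]).

    For the second part, scalar phases [e^(i a)] commute with U(2), so the
    image of a toric set under a unitary matrix is invariant under them; the
    bidisk is not ([bidisk_not_toric]). *)

(** * Continuity of matrix-valued maps and the unit sphere *)
Section Continuity.
Context {R : realType}.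

Lemma continuous_mx_at {T : topologicalType} m n (f : T -> 'M[R]_(m, n)) x :
  (forall i j, {for x, continuous (fun y => f y i j)}) -> {for x, continuous f}.
Proof.
move=> cf A [P hP PA].
have Pf : \forall y \near x, forall i j, P i j (f y i j).
  apply: filter_forall => i; apply: filter_forall => j.
  exact: (cf i j _ (hP i j)).
by apply: filterS Pf => y hy; exact: PA.
Qed.

Lemma continuous_mx {T : topologicalType} m n (f : T -> 'M[R]_(m, n)) :
  (forall i j, continuous (fun x => f x i j)) -> continuous f.
Proof. by move=> cf x; apply: continuous_mx_at => i j; exact: cf. Qed.

Lemma continuous_add {T : topologicalType} (f g : T -> R) :
  continuous f -> continuous g -> continuous (fun x => f x + g x).
Proof. by move=> cf cg x; apply: cvgD; [exact: cf | exact: cg]. Qed.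

Lemma continuous_mul {T : topologicalType} (f g : T -> R) :
  continuous f -> continuous g -> continuous (fun x => f x * g x).
Proof. by move=> cf cg x; apply: cvgM; [exact: cf | exact: cg]. Qed.

Lemma continuous_scale {T : topologicalType} (c : R) (f : T -> R) :
  continuous f -> continuous (fun x => c * f x).
Proof. by move=> cf; apply: continuous_mul => // x; exact: cst_continuous. Qed.

Lemma continuous_sum {T : topologicalType} {I : Type} (s : seq I)
    (f : I -> T -> R) :
  (forall i, continuous (f i)) -> continuous (fun x => \sum_(i <- s) f i x).
Proof.
move=> cf; elim: s => [|i s IHs].
  under eq_fun do rewrite big_nil.
  by move=> x; exact: cst_continuous.
under eq_fun do rewrite big_cons.
by move=> x; apply: cvgD; [exact: cf | exact: IHs].
Qed.

Lemma mulmx_continuous {T : topologicalType} m n p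
    (f : T -> 'M[R]_(m, n)) (g : T -> 'M[R]_(n, p)) :
  continuous f -> continuous g -> continuous (fun x => f x *m g x).
Proof.
move=> cf cg; apply: continuous_mx => i j.
under eq_fun do rewrite mxE.
apply: continuous_sum => k x; apply: cvgM.
  exact: (continuous_comp (cf x) (@coord_continuous _ _ _ i k _)).
exact: (continuous_comp (cg x) (@coord_continuous _ _ _ k j _)).
Qed.

Lemma mulmxl_continuous m n p (A : 'M[R]_(m, n)) :
  continuous (fun v : 'M[R]_(n, p) => A *m v).
Proof.
apply: mulmx_continuous => [x|x]; first exact: cst_continuous.
exact: cvg_id.
Qed.

Lemma dotp_continuous {T : topologicalType} d (f g : T -> 'cV[R]_d) :
  continuous f -> continuous g -> continuous (fun x => dotp (f x) (g x)).
Proof.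
move=> cf cg; apply: continuous_sum => k x; apply: cvgM.
  exact: (continuous_comp (cf x) (@coord_continuous _ _ _ k 0 _)).
exact: (continuous_comp (cg x) (@coord_continuous _ _ _ k 0 _)).
Qed.

End Continuity.

Section DotProduct.
Context {R : realType}.

Lemma dotpE d (u v : 'cV[R]_d) : dotp u v = (u^T *m v) 0 0.
Proof. by rewrite mxE; apply: eq_bigr => i _; rewrite mxE. Qed.

Lemma dotp_mulmxl d (A : 'M[R]_d) (u v : 'cV[R]_d) :
  dotp (A *m u) v = dotp u (A^T *m v).
Proof. by rewrite !dotpE trmx_mul mulmxA. Qed.

Lemma sphere_mulmx d (Q : 'M[R]_d) (u : 'cV[R]_d) :
  orthogonal_mx Q -> sphere (Q *m u) <-> sphere u.
Proof. by rewrite /sphere /= dotp_mulmxl mulmxA => ->; rewrite mul1mx. Qed.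

Lemma orthogonal_trmx d (Q : 'M[R]_d) : orthogonal_mx Q -> orthogonal_mx Q^T.
Proof. by rewrite /orthogonal_mx /= trmxK => /mulmx1C. Qed.

Lemma rotation_trmx d (Q : 'M[R]_d) : rotation_mx Q -> rotation_mx Q^T.
Proof. by move=> [/orthogonal_trmx ? Q1]; split; rewrite ?det_tr. Qed.

End DotProduct.

Section SphereTopology.
Context {R : realType} {d : nat}.

Lemma closed_sphere : closed (@sphere R d).
Proof.
have cf : continuous (fun u : 'cV[R]_d => dotp u u).
  by apply: dotp_continuous => x; exact: cvg_id.
exact: ((continuous_closedP _).1 cf [set 1] (@closed_eq _ 1)).
Qed.

Lemma sphere_coord (u : 'cV[R]_d) i : sphere u -> `|u i 0| <= 1.
Proof.
move=> Su; rewrite -(@expr_le1 _ 2) // real_normK ?num_real // -Su.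
rewrite /dotp (bigD1 i) //= -expr2 lerDl.
by apply: sumr_ge0 => k _; rewrite -expr2 sqr_ge0.
Qed.

Lemma compact_sphere : compact (@sphere R d).
Proof.
have ctr : continuous (fun v : 'rV[R]_d => v^T).
  apply: continuous_mx => i j; under eq_fun do rewrite mxE.
  exact: coord_continuous.
have -> : @sphere R d = trmx @` [set v : 'rV[R]_d | sphere v^T].
  rewrite eqEsubset; split => [u Su|_ [v Sv <-] //].
  by exists u^T; rewrite ?trmxK //= trmxK.
apply: continuous_compact.
  by apply: continuous_subspaceT => x; exact: ctr.
apply: bounded_closed_compact; last first.
  exact: ((continuous_closedP _).1 ctr _ closed_sphere).
exists 1; split => // M M1 v /= Sv.
apply: ltW; apply: le_lt_trans M1; rewrite /Num.norm /= mx_normrE.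
apply: bigmax_le => // -[i j] _ /=.
by have := sphere_coord j Sv; rewrite mxE ord1.
Qed.

End SphereTopology.

(** * Averages over the sphere *)
Section Average.
Context {R : realType} {d : nat}.
Variable sigma : probability (borel_space R d) R.

Definition average (f : 'cV[R]_d -> R) : R := \int[sigma]_(u in @sphere R d) f u.

Lemma measurable_sphere : measurable (@sphere R d : set (borel_space R d)).
Proof.
rewrite -[X in measurable X]setCK; apply: measurableC.
apply: sub_sigma_algebra; exact: closed_openC closed_sphere.
Qed.

Lemma continuous_measurable_borel (D : set (borel_space R d)) (f : 'cV[R]_d -> R) :
  continuous f -> measurable_fun D (f : borel_space R d -> R).
Proof.
move=> /continuousP cf; apply: measurable_funTS.
apply: (measurability _ (RGenOpens.measurableE R)).
move=> _ [_ [a [b ->] <-]]; rewrite setTI.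
by apply: sub_sigma_algebra; apply: cf; exact: interval_open.
Qed.

Lemma integrable_continuous (f : 'cV[R]_d -> R) :
  continuous f -> sigma.-integrable (@sphere R d) (EFin \o f).
Proof.
move=> cf; apply: measurable_bounded_integrable.
- exact: measurable_sphere.
- by apply: le_lt_trans (ltry 1); apply: probability_le1; exact: measurable_sphere.
- exact: continuous_measurable_borel.
have /compact_bounded [M [Mr hM]] : compact (f @` @sphere R d).
  apply: continuous_compact compact_sphere.
  by apply: continuous_subspaceT => x; exact: cf.
exists M; split => // N MN u Su; exact: (hM N MN _ (ex_intro2 _ _ u Su erefl)).
Qed.

Lemma eq_average (f g : 'cV[R]_d -> R) : (forall u, sphere u -> f u = g u) ->
  average f = average g.
Proof. by move=> fg; apply: eq_Rintegral => u /set_mem; exact: fg. Qed.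

Lemma averageD (f g : 'cV[R]_d -> R) : continuous f -> continuous g ->
  average (fun u => f u + g u) = average f + average g.
Proof.
move=> cf cg; apply: RintegralD; first exact: measurable_sphere.
all: exact: integrable_continuous.
Qed.

Lemma averageZ (c : R) (f : 'cV[R]_d -> R) : continuous f ->
  average (fun u => c * f u) = c * average f.
Proof.
move=> cf; apply: RintegralZl; first exact: measurable_sphere.
exact: integrable_continuous.
Qed.

Lemma average_cst (c : R) : sigma (@sphere R d) = 1%E ->
  average (fun=> c) = c.
Proof.
move=> s1; rewrite /average (Rintegral_cst _ measurable_sphere).
by rewrite [X in fine X]s1 mulr1.
Qed.

Lemma le_average (f g : 'cV[R]_d -> R) : continuous f -> continuous g ->
  (forall u, sphere u -> f u <= g u) -> average f <= average g.
Proof.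
move=> cf cg fg.
exact: (le_Rintegral measurable_sphere (integrable_continuous cf)
  (integrable_continuous cg)).
Qed.

Lemma average_sum {I : Type} (s : seq I) (f : I -> 'cV[R]_d -> R) :
  (forall i, continuous (f i)) ->
  average (fun u => \sum_(i <- s) f i u) = \sum_(i <- s) average (f i).
Proof.
move=> cf; elim: s => [|i s IHs].
  rewrite big_nil; transitivity (average (fun=> 0)).
    by apply: eq_average => u _; rewrite big_nil.
  rewrite -[RHS](mul0r (average (fun=> 0))) -averageZ; last first.
    by move=> x; exact: cst_continuous.
  by apply: eq_average => u _; rewrite mul0r.
rewrite big_cons -IHs -averageD //; last exact: continuous_sum.
by apply: eq_average => u _; rewrite big_cons.
Qed.

Hypothesis sigma_inv : rotation_invariant_on_sphere sigma.

Lemma mulmx_measurable (Q : 'M[R]_d) :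
  measurable_fun setT ((fun v => Q *m v) : borel_space R d -> borel_space R d).
Proof.
apply: (@measurability _ _ (borel_space R d) (borel_space R d) setT
  (fun v => Q *m v) (@open 'cV[R]_d)) => //.
move=> _ [B oB <-]; rewrite setTI; apply: sub_sigma_algebra.
by have /continuousP := @mulmxl_continuous R d d 1 Q; apply.
Qed.

(** The invariance of [sigma] is stated for direct images [Q A]; applied to
    [Q^T], whose direct images are the preimages by [Q], it says that [sigma]
    is its own pushforward by [Q]. *)
Lemma average_rotation (Q : 'M[R]_d) (f : 'cV[R]_d -> R) :
  rotation_mx Q -> continuous f -> average (fun u => f (Q *m u)) = average f.
Proof.
move=> rQ cf; have mQ := mulmx_measurable Q.
have QS : (fun v => Q *m v) @^-1` @sphere R d = @sphere R d.
  by apply/seteqP; split=> u /=; rewrite sphere_mulmx //; case: rQ.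
have cfQ : continuous (fun u => f (Q *m u)).
  by move=> x; apply: continuous_comp; [exact: mulmxl_continuous | exact: cf].
congr fine; have := @integral_pushforward _ _ _ _ _ _ mQ sigma (@sphere R d)
  (EFin \o f) _ _ measurable_sphere.
rewrite QS => <- //; last first.
- exact: integrable_continuous.
- by apply/measurable_EFinP; exact: continuous_measurable_borel.
apply: eq_measure_integral => A mA _; rewrite /pushforward.
have [oQ dQ] := rQ.
have Qi := rotation_trmx rQ.
apply: etrans (sigma_inv.2 _ Qi _ mA); rewrite /image_mx.
congr (sigma _); apply/seteqP; split => [u /= Au|_ [v Av <-]] /=.
  by exists (Q *m u) => //; rewrite mulmxA oQ mul1mx.
by rewrite mulmxA mulmx1C // mul1mx.
Qed.

Hypothesis rotation_transitive : forall p q : 'cV[R]_d, sphere p -> sphere q ->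
  exists2 Q : 'M[R]_d, rotation_mx Q & Q *m q = p.

(** The open sets where [w (Q u) > w p / 2], for [Q] a rotation, cover the
    sphere because some rotation takes any given point to [p].  By compactness
    finitely many suffice.  As [w] is nonnegative, a finite sum of rotated copies
    of [w] is then at least [w p / 2] on the whole sphere, and all its terms have
    the same average. *)
Lemma average_gt0 (w : 'cV[R]_d -> R) p : continuous w ->
  (forall u, sphere u -> 0 <= w u) -> sphere p -> 0 < w p -> 0 < average w.
Proof.
move=> cw w0 Sp wp.
have /choice [rot rotP] : forall q : 'cV[R]_d, exists Q : 'M[R]_d,
    rotation_mx Q /\ (sphere q -> Q *m q = p).
  move=> q; have [Sq|nSq] := pselect (sphere q).
    by have [Q rQ Qq] := rotation_transitive Sp Sq; exists Q.
  exists 1%:M; split => //; rewrite /rotation_mx /orthogonal_mx /=.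
  by rewrite trmx1 mulmx1 det1.
have cwr q : continuous (fun u => w (rot q *m u)).
  by move=> x; apply: continuous_comp; [exact: mulmxl_continuous | exact: cw].
have := @compact_sphere R d; rewrite compact_cover.
move=> /(_ _ (@sphere R d) (fun q => [set u | w p / 2 < w (rot q *m u)])) [].
- move=> q _; apply: (@open_comp _ _ (fun u => w (rot q *m u)) [set x | w p / 2 < x]).
    by move=> x _; exact: cwr.
  exact: open_gt.
- move=> q Sq; exists q => //=; rewrite (rotP q).2 //.
  by rewrite ltr_pdivrMr // ltr_pMr // ltr1n.
move=> D DS cover; rewrite ltNge; apply/negP => w_le0.
have : w p / 2 <= 0; last by rewrite leNgt divr_gt0.
rewrite -[w p / 2](average_cst _ sigma_inv.1).
have le_sum : average (fun=> w p / 2) <=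
    average (fun u => \sum_(q <- D) w (rot q *m u)).
  apply: le_average => [x||u Su]; first exact: cst_continuous.
    exact: continuous_sum.
  have [q qD /= /ltW wq] := cover u Su; apply: le_trans wq _.
  rewrite (big_fsetD1 q) //= lerDl; apply: sumr_ge0 => i _.
  by apply: w0; rewrite sphere_mulmx //; exact: (rotP i).1.1.
apply: le_trans le_sum _; rewrite average_sum //; apply: sumr_le0 => q _.
by rewrite average_rotation //; exact: (rotP q).1.
Qed.

Lemma lt_average (f g : 'cV[R]_d -> R) p : continuous f -> continuous g ->
  (forall u, sphere u -> f u <= g u) -> sphere p -> f p < g p ->
  average f < average g.
Proof.
move=> cf cg fg Sp fgp; rewrite -subr_gt0.
have cNf : continuous (fun u => -1 * f u) by exact: continuous_scale.
rewrite -mulN1r -averageZ // -averageD //.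
apply: (@average_gt0 _ p) => // [|u Su|]; last by rewrite mulN1r subr_gt0.
  exact: continuous_add.
by rewrite mulN1r subr_ge0 fg.
Qed.

End Average.

(** * The Euclidean norm and the support function of the bidisk *)
Section EuclideanNorm.
Context {R : realType} {d : nat}.
Implicit Types u v w : 'cV[R]_d.

Lemma dotpC u v : dotp u v = dotp v u.
Proof. by apply: eq_bigr => i _; rewrite mulrC. Qed.

Lemma dotpDr u v w : dotp u (v + w) = dotp u v + dotp u w.
Proof. by rewrite !dotpE mulmxDr mxE. Qed.

Lemma dotpZr c u v : dotp u (c *: v) = c * dotp u v.
Proof. by rewrite !dotpE -scalemxAr mxE. Qed.

Lemma dotp_ge0 u : 0 <= dotp u u.
Proof. by apply: sumr_ge0 => i _; rewrite -expr2 sqr_ge0. Qed.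

Lemma dotp_eq0 u : dotp u u = 0 -> u = 0.
Proof.
move=> /eqP; rewrite psumr_eq0 => [/allP u0|i _]; last by rewrite -expr2 sqr_ge0.
apply/matrixP => i j; rewrite ord1 mxE; apply/eqP.
by have := u0 i (mem_index_enum _); rewrite mulf_eq0 orbb.
Qed.

(** Cauchy-Schwarz, from [0 <= |a u - b v|^2] with [a = <v, v>] and
    [b = <u, v>]. *)
Lemma dotp_le_sqr u v : dotp u v ^+ 2 <= dotp u u * dotp v v.
Proof.
have [/eqP/dotp_eq0 ->|v0] := boolP (dotp v v == 0).
  by rewrite !dotpE !mulmx0 !mxE expr0n mulr0.
have vv : 0 < dotp v v by rewrite lt_def v0 dotp_ge0.
set a := dotp v v in vv *; set b := dotp u v.
have := dotp_ge0 (a *: u + (- b) *: v).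
have -> : dotp (a *: u + (- b) *: v) (a *: u + (- b) *: v)
    = a * (dotp u u * a - b ^+ 2).
  rewrite dotpDr !dotpZr ![dotp (_ + _) _]dotpC !dotpDr !dotpZr.
  by rewrite (dotpC v u) -/a -/b; ring.
by rewrite pmulr_rge0 // subr_ge0.
Qed.

Definition enorm u : R := Num.sqrt (dotp u u).

Lemma enorm_ge0 u : 0 <= enorm u. Proof. exact: sqrtr_ge0. Qed.

Lemma sqr_enorm u : enorm u ^+ 2 = dotp u u.
Proof. by rewrite sqr_sqrtr // dotp_ge0. Qed.

Lemma dotp_le u v : dotp u v <= enorm u * enorm v.
Proof.
rewrite -sqrtrM ?dotp_ge0 //; apply: le_trans (ler_norm _) _.
by rewrite -sqrtr_sqr ler_wsqrtr // dotp_le_sqr.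
Qed.

Lemma enorm0 : enorm 0 = 0.
Proof. by rewrite /enorm dotpE mulmx0 mxE sqrtr0. Qed.

Lemma enorm_gt0 u : u != 0 -> 0 < enorm u.
Proof.
move=> u0; rewrite sqrtr_gt0 lt_def dotp_ge0 andbT.
by apply: contra_neq u0; exact: dotp_eq0.
Qed.

Lemma enormZ c u : enorm (c *: u) = `|c| * enorm u.
Proof.
rewrite /enorm dotpZr dotpC dotpZr mulrA -expr2 sqrtrM ?sqr_ge0 //.
by rewrite sqrtr_sqr.
Qed.

Lemma enormN u : enorm (- u) = enorm u.
Proof. by rewrite -scaleN1r enormZ normrN1 mul1r. Qed.

Lemma ler_enormD u v : enorm (u + v) <= enorm u + enorm v.
Proof.
rewrite -(@ler_pXn2r _ 2) // ?nnegrE ?addr_ge0 ?enorm_ge0 //.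
rewrite sqr_enorm dotpDr ![dotp (_ + _) _]dotpC !dotpDr (dotpC v u).
rewrite sqrrD !sqr_enorm; have := dotp_le u v; lra.
Qed.

Lemma enorm_convex t u v : 0 <= t -> t <= 1 ->
  enorm (t *: u + (1 - t) *: v) <= t * enorm u + (1 - t) * enorm v.
Proof.
move=> t0 t1; apply: le_trans (ler_enormD _ _) _.
by rewrite !enormZ !ger0_norm // subr_ge0.
Qed.

Lemma enorm_orthogonal (W : 'M[R]_d) u : orthogonal_mx W ->
  enorm (W *m u) = enorm u.
Proof. by rewrite /enorm dotp_mulmxl mulmxA => ->; rewrite mul1mx. Qed.

Lemma enorm_continuous {T : topologicalType} (f : T -> 'cV[R]_d) :
  continuous f -> continuous (fun x => enorm (f x)).
Proof.
move=> cf x.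
apply: (@continuous_comp _ _ _ (fun x => dotp (f x) (f x)) (@Num.sqrt R)).
  exact: dotp_continuous.
exact: sqrt_continuous.
Qed.

End EuclideanNorm.

Section SupportFunction.
Context {R : realType}.
Implicit Types (u v : 'cV[R]_(2 + 2)) (P : 'M[R]_(2 + 2)).

Definition bidisk_support u : R := enorm (usubmx u) + enorm (dsubmx u).

Lemma dotp_split u v :
  dotp u v = dotp (usubmx u) (usubmx v) + dotp (dsubmx u) (dsubmx v).
Proof.
by rewrite /dotp big_split_ord; congr (_ + _); apply: eq_bigr => i _; rewrite !mxE.
Qed.

Lemma lagrangian_bidiskE v : lagrangian_bidisk v <->
  enorm (usubmx v) <= 1 /\ enorm (dsubmx v) <= 1.
Proof.
have E (w : 'cV[R]_2) : (w 0 0 ^+ 2 + w 1 0 ^+ 2 <= 1) = (enorm w <= 1).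
  rewrite -[RHS](@expr_le1 _ 2) ?enorm_ge0 // sqr_enorm.
  rewrite /dotp !big_ord_recl big_ord0 addr0 -!expr2.
  by congr (_ + w _ 0 ^+ 2 <= 1); apply/val_inj.
by rewrite /lagrangian_bidisk /= !E.
Qed.

Lemma bidisk_supportN u : bidisk_support (- u) = bidisk_support u.
Proof. by rewrite /bidisk_support !linearN !enormN. Qed.

(** The supremum of [<k, v>] over the bidisk is attained at the point whose two
    blocks are the normalised blocks of [v]; when a block of [v] vanishes, so
    does the corresponding block of that point, and the value is still right. *)
Lemma support_bidisk P u :
  support_fun (image_mx P (@lagrangian_bidisk R)) u = bidisk_support (P^T *m u).
Proof.
set v := P^T *m u; pose unit (w : 'cV[R]_2) := (enorm w)^-1 *: w.
have unitP w : enorm (unit w) <= 1 /\ dotp (unit w) w = enorm w.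
  rewrite enormZ normfV ger0_norm ?enorm_ge0 // dotpC dotpZr -sqr_enorm.
  have [->|w0] := eqVneq w 0; first by rewrite enorm0 mulr0 expr0n mulr0.
  have nw := lt0r_neq0 (enorm_gt0 w0).
  by rewrite mulVf // expr2 mulKf.
rewrite /support_fun; set A := (X in sup X).
have ubA : ubound A (bidisk_support v).
  move=> _ [_ [k /lagrangian_bidiskE [kx ky] <-] <-].
  rewrite dotp_mulmxl -/v dotp_split; apply: lerD.
    apply: le_trans (dotp_le _ _) _; exact: ler_piMl (enorm_ge0 _) kx.
  apply: le_trans (dotp_le _ _) _; exact: ler_piMl (enorm_ge0 _) ky.
have Av : A (bidisk_support v).
  pose k := col_mx (unit (usubmx v)) (unit (dsubmx v)).
  exists (P *m k).
    exists k => //; apply/lagrangian_bidiskE; rewrite col_mxKu col_mxKd.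
    by split; [exact: (unitP _).1 | exact: (unitP _).1].
  rewrite dotp_mulmxl -/v dotp_split col_mxKu col_mxKd.
  by rewrite !(unitP _).2.
apply/eqP; rewrite eq_le; apply/andP; split.
  by apply: ge_sup => //; exists (bidisk_support v).
by apply: ub_le_sup => //; exists (bidisk_support v).
Qed.

Lemma bidisk_support_continuous P :
  continuous (fun u => bidisk_support (P *m u)).
Proof.
apply: continuous_add; apply: enorm_continuous; apply: continuous_mx => i j;
  under eq_fun do rewrite mxE;
  move=> x; apply: (@continuous_comp _ _ _ (fun u => P *m u)
    (fun u : 'cV[R]_(2 + 2) => u _ j));
  by [exact: mulmxl_continuous | exact: coord_continuous].
Qed.

Lemma mean_width_bidisk (sigma : probability (borel_space R (2 + 2)) R) P :
  mean_width sigma (image_mx P (@lagrangian_bidisk R)) =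
  2 * average sigma (fun u => bidisk_support (P^T *m u)).
Proof.
rewrite -averageZ; last exact: bidisk_support_continuous.
apply: eq_average => u _.
by rewrite !support_bidisk mulmxN bidisk_supportN mulr_natl mulr2n.
Qed.

End SupportFunction.

(** * Symplectic and unitary matrices *)
Section TwoByTwo.
Context {R : comNzRingType}.
Implicit Types (M N : 'M[R]_2).

Lemma ord2P (i : 'I_2) : i = 0 \/ i = 1.
Proof. by case: i => [[|[|//]] ?]; [left | right]; apply/val_inj. Qed.

Definition mx2 (a b c d : R) : 'M[R]_2 :=
  \matrix_(i, j) if i == 0 then if j == 0 then a else b
                 else if j == 0 then c else d.

Lemma big_ord2 (f : 'I_2 -> R) : \sum_i f i = f 0 + f 1.
Proof. by rewrite !big_ord_recl big_ord0 addr0; congr (_ + f _); apply/val_inj. Qed.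

Lemma mx2P M N : M 0 0 = N 0 0 -> M 0 1 = N 0 1 -> M 1 0 = N 1 0 ->
  M 1 1 = N 1 1 -> M = N.
Proof.
move=> h00 h01 h10 h11; apply/matrixP => i j.
by case: (ord2P i) => ->; case: (ord2P j) => ->.
Qed.

Lemma det_mx2 M : \det M = M 0 0 * M 1 1 - M 0 1 * M 1 0.
Proof.
rewrite (expand_det_row _ 0) big_ord2 /cofactor !det_mx11 !mxE /=.
have -> : lift 0 0 = 1 :> 'I_2 by apply/val_inj.
have -> : lift 1 0 = 0 :> 'I_2 by apply/val_inj.
by rewrite /= expr0 expr1 mul1r mulN1r mulrN.
Qed.

End TwoByTwo.

Section ComplexStructure.
Context {R : realType}.
Implicit Types (A B C E : 'M[R]_2) (P Q : 'M[R]_(2 + 2)).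

(** The determinant of a complex-linear map over the reals is the squared
    modulus of its complex determinant, here [det (A + i B)]. *)
Lemma det_complex_block A B :
  \det (block_mx A (- B) B A) =
  (\det A - \det B) ^+ 2 +
  (A 0 0 * B 1 1 + B 0 0 * A 1 1 - A 0 1 * B 1 0 - B 0 1 * A 1 0) ^+ 2.
Proof.
(* a table indexed by numbers, so that the indices of minors compute *)
pose f (i j : nat) : R :=
  match i, j with
  | 0%N, 0%N | 2, 2 => A 0 0 | 0%N, 1%N | 2, 3 => A 0 1
  | 1%N, 0%N | 3, 2 => A 1 0 | 1%N, 1%N | 3, 3 => A 1 1
  | 2, 0%N => B 0 0 | 2, 1%N => B 0 1 | 3, 0%N => B 1 0 | 3, 1%N => B 1 1
  | 0%N, 2 => - B 0 0 | 0%N, 3 => - B 0 1 | 1%N, 2 => - B 1 0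
  | _, _ => - B 1 1
  end.
have -> : block_mx A (- B) B A = \matrix_(i < 2 + 2, j < 2 + 2) f i j
    :> 'M[R]_(2 + 2).
  apply/matrixP => i j; rewrite -(fintype.splitK i) -(fintype.splitK j).
  case: (fintype.split i) => i'; case: (fintype.split j) => j' /=;
    rewrite ?block_mxEul ?block_mxEur ?block_mxEdl ?block_mxEdr !mxE;
    by case: (ord2P i') => ->; case: (ord2P j') => ->.
rewrite !det_mx2.
rewrite (expand_det_row _ 0) !big_ord_recl big_ord0 /cofactor.
rewrite !(expand_det_row _ 0) !big_ord_recl !big_ord0 /cofactor.
rewrite !det_mx2.
rewrite !mxE /=.
ring.
Qed.

Lemma Sp4_blockP A B C E : Sp4 (block_mx A B C E) <->
  [/\ A^T *m C = C^T *m A, B^T *m E = E^T *m B & A^T *m E - C^T *m B = 1%:M].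
Proof.
rewrite /Sp4 /= /omega_mx tr_block_mx !mulmx_block.
rewrite !mulmx0 !mulmx1 !mulmxN !mulmx1 !add0r !addr0 !mulNmx.
split=> [/eq_block_mx [eA eB _ eE]|[-> <- eAE]].
  split; [apply/eqP | apply/eqP | by rewrite -eB addrC].
    by rewrite -subr_eq0 addrC eA.
  by rewrite -subr_eq0 addrC eE.
rewrite !addNr [- _ + _]addrC eAE; congr block_mx.
have := congr1 trmx eAE; rewrite trmx1 linearB /= !trmx_mul !trmxK => <-.
by rewrite opprB addrC.
Qed.

Lemma U2_block A C :
  A^T *m A + C^T *m C = 1%:M -> A^T *m C = C^T *m A ->
  U2 (block_mx A (- C) C A).
Proof.
move=> AC1 ACC; split.
  apply/Sp4_blockP; split => //; last by rewrite mulmxN opprK.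
  by rewrite linearN /= mulNmx mulmxN ACC.
have trN : (- C)^T = - C^T by rewrite linearN.
rewrite /orthogonal_mx /= tr_block_mx mulmx_block trN !mulNmx !mulmxN opprK.
by rewrite AC1 [C^T *m C + _]addrC AC1 ACC addNr -scalar_mx_block.
Qed.

Lemma Sp4_mul P Q : Sp4 P -> Sp4 Q -> Sp4 (P *m Q).
Proof.
rewrite /Sp4 /= => sP sQ.
by rewrite -[RHS]sQ -[X in Q^T *m X *m Q]sP trmx_mul !mulmxA.
Qed.

Lemma orthogonal_mul d (P Q : 'M[R]_d) :
  orthogonal_mx P -> orthogonal_mx Q -> orthogonal_mx (P *m Q).
Proof.
rewrite /orthogonal_mx /= => oP oQ.
by rewrite trmx_mul mulmxA -(mulmxA _ P^T) oP mulmx1.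
Qed.

Lemma U2_mul P Q : U2 P -> U2 Q -> U2 (P *m Q).
Proof.
by move=> [sP oP] [sQ oQ]; split; [exact: Sp4_mul | exact: orthogonal_mul].
Qed.

Lemma U2_omegaC Q : U2 Q -> omega_mx R *m Q = Q *m omega_mx R.
Proof.
move=> [sQ oQ]; rewrite -[in RHS]sQ -mulmxA mulmxA.
by rewrite (mulmx1C oQ) mul1mx.
Qed.

Lemma U2_trmx Q : U2 Q -> U2 Q^T.
Proof.
move=> uQ; split; last exact: orthogonal_trmx uQ.2.
by rewrite /Sp4 /= trmxK -U2_omegaC // -mulmxA (mulmx1C uQ.2) mulmx1.
Qed.

(** Orthogonality gives [det Q = 1] or [-1]; a unitary matrix is complex-linear,
    so its real determinant is nonnegative. *)
Lemma U2_rotation Q : U2 Q -> rotation_mx Q.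
Proof.
move=> uQ; split; first exact: uQ.2.
have : 0 <= \det Q.
  move: (U2_omegaC uQ); rewrite -[Q]submxK /omega_mx !mulmx_block.
  rewrite !mul0mx !mulmx0 !mul1mx !mulmx1 !mulNmx !mulmxN !mul1mx !mulmx1.
  rewrite !add0r !addr0 => /eq_block_mx [eC -> _ _].
  by rewrite -[ursubmx Q]opprK -eC det_complex_block addr_ge0 ?sqr_ge0.
have : \det Q ^+ 2 = 1 by rewrite expr2 -{1}det_tr -det_mulmx uQ.2 det1.
by move=> /eqP; rewrite sqrf_eq1 => /orP [/eqP //|/eqP ->]; rewrite oppr_ge0 ler10.
Qed.

Lemma U2_diag_block (W : 'M[R]_2) : orthogonal_mx W -> U2 (block_mx W 0 0 W).
Proof.
move=> oW; rewrite -[X in block_mx _ X]oppr0; apply: U2_block.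
  by rewrite oW trmx0 mul0mx addr0.
by rewrite trmx0 mulmx0 mul0mx.
Qed.

(** Any unit vector [(z_1, z_2)] is the first column of a unitary matrix: take
    [(- conj z_2, conj z_1)] as the second one. *)
Lemma U2_transitive (p q : 'cV[R]_(2 + 2)) : sphere p -> sphere q ->
  exists2 Q, U2 Q & Q *m q = p.
Proof.
pose e : 'cV[R]_(2 + 2) := col_mx (delta_mx 0 0) 0.
suff frame r : sphere r -> exists2 Q, U2 Q & Q *m e = r.
  move=> /frame [P uP Pe] /frame [Q uQ Qe]; exists (P *m Q^T).
    by apply: U2_mul => //; exact: U2_trmx.
  by rewrite -Qe -mulmxA [Q^T *m _]mulmxA uQ.2 mul1mx.
rewrite /sphere /= dotp_split; set x := usubmx r; set y := dsubmx r.
rewrite /dotp !big_ord2 => Sr.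
rewrite /x /y !mxE in Sr.
pose A := mx2 (x 0 0) (- x 1 0) (x 1 0) (x 0 0).
pose C := mx2 (y 0 0) (y 1 0) (y 1 0) (- y 0 0).
exists (block_mx A (- C) C A).
  apply: U2_block; apply: mx2P; rewrite !mxE !big_ord2 !mxE /=; lra.
rewrite mul_block_col !mulmx0 !addr0 -[RHS]vsubmxK -!colE.
by congr col_mx; apply/matrixP => i j; rewrite (ord1 j) !mxE;
  case: (ord2P i) => ->; rewrite /= ?mxE.
Qed.

End ComplexStructure.

(** * The normal form of a symplectic matrix *)
Section NormalForm.
Context {R : realType}.

Definition dilation_shear (d : 'rV[R]_2) (S : 'M[R]_2) : 'M[R]_(2 + 2) :=
  block_mx (diag_mx d) (diag_mx d *m S) 0 (diag_mx (map_mx GRing.inv d)).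

Lemma diag_mxV (d : 'rV[R]_2) : (forall i, 0 < d 0 i) ->
  diag_mx d *m diag_mx (map_mx GRing.inv d) = 1%:M.
Proof.
move=> d0; rewrite mulmx_diag -diag_const_mx; congr diag_mx.
apply/matrixP => i j; rewrite (ord1 i) !mxE divff //.
exact: lt0r_neq0 (d0 j).
Qed.

Lemma diagV_mx (d : 'rV[R]_2) : (forall i, 0 < d 0 i) ->
  diag_mx (map_mx GRing.inv d) *m diag_mx d = 1%:M.
Proof. by move=> /diag_mxV /mulmx1C. Qed.

Lemma Sp4_dilation_shear (d : 'rV[R]_2) (S : 'M[R]_2) : (forall i, 0 < d 0 i) ->
  Sp4 (dilation_shear d S) <-> S^T = S.
Proof.
move=> d0; rewrite Sp4_blockP !tr_diag_mx !trmx0 mulmx0 mul0mx mul0mx subr0.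
rewrite diag_mxV // mulmxA diagV_mx // mul1mx trmx_mul tr_diag_mx.
rewrite -mulmxA diag_mxV // mulmx1.
by split=> [[]|].
Qed.

(** Unless [G] is already diagonal, [W] is the rotation whose first column is
    the normalised eigenvector [(q, l - p)] for an eigenvalue [l] of [G]. *)
Lemma symmetric_mx2_diagonalize (G : 'M[R]_2) : G^T = G ->
  exists2 W : 'M[R]_2, orthogonal_mx W & exists g, W^T *m G *m W = diag_mx g.
Proof.
move=> sG; set p := G 0 0; set q := G 0 1; set r := G 1 1.
have G10 : G 1 0 = q by rewrite -sG mxE.
have [q0|q0] := eqVneq q 0.
  exists 1%:M; first by rewrite /orthogonal_mx /= trmx1 mulmx1.
  exists (\row_i G i i); rewrite trmx1 mul1mx mulmx1.
  by apply: mx2P; rewrite !mxE ?G10 //= ?mulr1n ?mulr0n.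
(* the larger root of the characteristic polynomial *)
pose l := (p + r + Num.sqrt ((p - r) ^+ 2 + 4 * q ^+ 2)) / 2.
have lP : (l - p) * (l - r) = q ^+ 2.
  have : Num.sqrt ((p - r) ^+ 2 + 4 * q ^+ 2) ^+ 2 = (p - r) ^+ 2 + 4 * q ^+ 2.
    by rewrite sqr_sqrtr // addr_ge0 ?sqr_ge0 // mulr_ge0 ?sqr_ge0.
  rewrite /l; set s := Num.sqrt _ => s2.
  transitivity ((s ^+ 2 - (p - r) ^+ 2) / 4); first by field.
  by rewrite s2; field.
pose n := Num.sqrt (q ^+ 2 + (l - p) ^+ 2).
have n0 : n != 0.
  rewrite gt_eqF // sqrtr_gt0 ltr_pwDl ?sqr_ge0 //.
  by rewrite lt_def sqrf_eq0 q0 sqr_ge0.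
pose c := q / n; pose s := (l - p) / n.
have cs1 : c ^+ 2 + s ^+ 2 = 1.
  rewrite !expr_div_n -mulrDl -[X in _ / X]/(n ^+ 2) sqr_sqrtr ?divff //.
    by rewrite -[X in X != _]sqr_sqrtr ?addr_ge0 ?sqr_ge0 // sqrf_eq0.
  by rewrite addr_ge0 ?sqr_ge0.
(* the off-diagonal entry of [W^T G W] vanishes *)
have off : c * s * (r - p) + q * (c ^+ 2 - s ^+ 2) = 0.
  transitivity (n^-1 ^+ 2 * q * (q ^+ 2 - (l - p) * (l - r))).
    by rewrite /c /s; ring.
  by rewrite lP subrr mulr0.
exists (mx2 c (- s) s c).
  by rewrite /orthogonal_mx /=; apply: mx2P; rewrite !mxE !big_ord2 !mxE /=; lra.
exists (\row_i ((mx2 c (- s) s c)^T *m G *m mx2 c (- s) s c) i i).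
apply: mx2P; rewrite ?[in RHS]mxE ?[in RHS]mxE ?mulr1n ?mulr0n //;
  rewrite !mxE !big_ord2 !mxE !big_ord2 !mxE /= G10 -/p -/q -/r; lra.
Qed.

(** An Iwasawa-type decomposition.  [W] diagonalises the Gram matrix of the
    first two columns of [P], so that the columns [(A; C)] of [P k] are
    orthogonal with squared norms [g].  These are nonzero because
    [A^T E - C^T B = 1], and [A^T C] is symmetric, so the normalised columns
    together with their images by the complex structure form a unitary [U].
    In that frame [P k] is block triangular with lower right block [D^-1]. *)
Lemma normal_form (P : 'M[R]_(2 + 2)) : Sp4 P ->
  exists U (W : 'M[R]_2) (d : 'rV[R]_2) S,
    [/\ U2 U, orthogonal_mx W, forall i, 0 < d 0 i, S^T = S &
        P = U *m dilation_shear d S *m block_mx W 0 0 W].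
Proof.
move=> sP.
pose G := (ulsubmx P)^T *m ulsubmx P + (dlsubmx P)^T *m dlsubmx P.
have sG : G^T = G by rewrite linearD /= !trmx_mul !trmxK.
have [W oW [g Wg]] := symmetric_mx2_diagonalize sG.
pose k := block_mx W 0 0 W; have uk : U2 k := U2_diag_block oW.
have sPk : Sp4 (P *m k) := Sp4_mul sP uk.1.
pose A := ulsubmx P *m W; pose C := dlsubmx P *m W.
pose B := ursubmx P *m W; pose E := drsubmx P *m W.
have Pk : P *m k = block_mx A B C E.
  by rewrite -[P]submxK mulmx_block !mulmx0 !addr0 !add0r.
have [AC BE AE] : [/\ A^T *m C = C^T *m A, B^T *m E = E^T *m B &
    A^T *m E - C^T *m B = 1%:M] by apply/Sp4_blockP; rewrite -Pk.
have gram : A^T *m A + C^T *m C = diag_mx g.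
  by rewrite -Wg mulmxDr mulmxDl !trmx_mul !mulmxA.
clearbody A B C E.
have g_gt0 i : 0 < g 0 i.
  have gE : g 0 i = dotp (col i A) (col i A) + dotp (col i C) (col i C).
    have := congr1 (fun M : 'M[R]_2 => M i i) gram.
    rewrite mxE mxE [RHS]mxE eqxx mulr1n => <-; rewrite mxE.
    by congr (_ + _); apply: eq_bigr => j _; rewrite !mxE.
  rewrite lt_def gE addr_ge0 ?dotp_ge0 // andbT.
  rewrite paddr_eq0 ?dotp_ge0 //; apply/negP => /andP [/eqP A0 /eqP C0].
  have := congr1 (fun M : 'M[R]_2 => M i i) AE.
  rewrite !mxE eqxx !big1 ?subr0 => [/eqP|j _|j _]; last 2 first.
  - have := congr1 (fun M : 'cV[R]_2 => M j 0) (dotp_eq0 C0).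
    by rewrite !mxE => ->; rewrite mul0r.
  - have := congr1 (fun M : 'cV[R]_2 => M j 0) (dotp_eq0 A0).
    by rewrite !mxE => ->; rewrite mul0r.
  by rewrite eq_sym oner_eq0.
pose d := map_mx Num.sqrt g.
have d_gt0 i : 0 < d 0 i by rewrite mxE sqrtr_gt0.
set D := diag_mx d; pose D' := diag_mx (map_mx GRing.inv d).
have DD : D *m D' = 1%:M := diag_mxV d_gt0.
have D'D : D' *m D = 1%:M := mulmx1C DD.
have D2 : diag_mx g = D *m D.
  rewrite mulmx_diag; congr diag_mx; apply/matrixP => i j.
  by rewrite (ord1 i) !mxE -expr2 sqr_sqrtr // ltW.
have trD' : D'^T = D' := tr_diag_mx _.
pose U := block_mx (A *m D') (- (C *m D')) (C *m D') (A *m D').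
have uU : U2 U.
  apply: U2_block; rewrite !trmx_mul trD'.
    transitivity (D' *m (A^T *m A + C^T *m C) *m D').
      by rewrite mulmxDr mulmxDl !mulmxA.
    by rewrite gram D2 mulmxA D'D mul1mx DD.
  by rewrite -mulmxA (mulmxA A^T) AC !mulmxA.
pose S := D' *m D' *m (A^T *m B + C^T *m E).
have UPk : U^T *m (P *m k) = dilation_shear d S.
  rewrite Pk tr_block_mx mulmx_block /dilation_shear.
  have trN : (- (C *m D'))^T = - (C *m D')^T by rewrite linearN.
  rewrite trN !trmx_mul trD' !mulNmx -!mulmxA -/D -/D'; congr block_mx.
  - by rewrite -mulmxDr gram D2 mulmxA D'D mul1mx.
  - by rewrite -mulmxDr /S !mulmxA DD mul1mx.
  - by rewrite AC addNr.
  - by rewrite addrC -mulmxBr AE mulmx1.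
have sS : S^T = S.
  apply/(Sp4_dilation_shear S d_gt0); rewrite -UPk; apply: Sp4_mul sPk.
  by have [] := U2_trmx uU.
exists U, W^T, d, S; split => //; first exact: orthogonal_trmx.
rewrite -UPk (mulmxA U) (mulmx1C uU.2) mul1mx -mulmxA.
rewrite mulmx_block !mulmx0 !mul0mx !addr0 !add0r (mulmx1C oW).
by rewrite -scalar_mx_block mulmx1.
Qed.

End NormalForm.

(** * Averages of norms of linear images *)
Section PlaneAverage.
Context {R : realType}.
Variable sigma : probability (borel_space R (2 + 2)) R.
Hypothesis sigma_inv : rotation_invariant_on_sphere sigma.
Implicit Types (M N : 'M[R]_(2, 2 + 2)) (K L : 'M[R]_2) (d : 'rV[R]_2).

(** Half the mean width of the ellipse that is the image of the unit disk under
    [M^T]. *)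
Definition map_average M : R := average sigma (fun u => enorm (M *m u)).

Lemma enorm_mulmx_continuous M : continuous (fun u => enorm (M *m u)).
Proof. by apply: enorm_continuous; exact: mulmxl_continuous. Qed.
Let cM := enorm_mulmx_continuous.

Lemma sphere_transitive (p q : 'cV[R]_(2 + 2)) : sphere p -> sphere q ->
  exists2 Q, rotation_mx Q & Q *m q = p.
Proof.
move=> Sp Sq; have [Q uQ Qq] := U2_transitive Sp Sq.
by exists Q => //; exact: U2_rotation.
Qed.

Lemma average_bidisk_support (P : 'M[R]_(2 + 2)) :
  average sigma (fun u => bidisk_support (P *m u)) =
  map_average (usubmx P) + map_average (dsubmx P).
Proof.
rewrite -averageD; [|exact: cM..]; apply: eq_average => u _.
by rewrite /bidisk_support -[P in P *m u]vsubmxK mul_col_mx col_mxKu col_mxKd.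
Qed.

Lemma map_average_rotation M (Q : 'M[R]_(2 + 2)) : rotation_mx Q ->
  map_average (M *m Q) = map_average M.
Proof.
move=> rQ; rewrite -[RHS](average_rotation sigma_inv rQ); last exact: cM.
by apply: eq_average => u _; rewrite mulmxA.
Qed.

Lemma map_average_convex t M N : 0 <= t -> t <= 1 ->
  map_average (t *: M + (1 - t) *: N) <=
  t * map_average M + (1 - t) * map_average N.
Proof.
move=> t0 t1; rewrite -!averageZ; [|exact: cM..].
have cZ (c : R) (L : 'M[R]_(2, 2 + 2)) := continuous_scale (c := c) (@cM L).
rewrite -averageD //; apply: le_average => [||u _].
- exact: cM.
- exact: continuous_add.
by rewrite mulmxDl -!scalemxAl; exact: enorm_convex.
Qed.

Lemma map_average_row_mxN K L :
  map_average (row_mx (- K) L) = map_average (row_mx K L).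
Proof.
rewrite -(@map_average_rotation _ (block_mx (- 1%:M) 0 0 1%:M)).
  by rewrite mul_row_block !mulmx0 addr0 add0r mulmxN !mulmx1 opprK.
split; last first.
  by rewrite det_ublock -scaleN1r detZ !det1 expr2 mulrNN !mulr1.
have trN1 : (- 1%:M)^T = - 1%:M :> 'M[R]_2 by rewrite linearN /= trmx1.
rewrite /orthogonal_mx /= tr_block_mx mulmx_block trN1 !trmx1 !trmx0.
rewrite !mulmx0 !mul0mx !addr0 add0r mulmxN mulNmx !mulmx1 opprK.
by rewrite -scalar_mx_block.
Qed.

Lemma map_average_row_mx0 K :
  map_average (row_mx 0 K) = map_average (row_mx K 0).
Proof.
rewrite -[RHS](@map_average_rotation _ (block_mx 0 (- - 1%:M) (- 1%:M) 0)).
  by rewrite mul_row_block !mulmx0 !mul0mx !addr0 opprK mulmx1.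
apply/U2_rotation/U2_block; rewrite ?trmx0 ?mul0mx ?mulmx0 ?add0r //.
have -> : (- 1%:M)^T = - 1%:M :> 'M[R]_2 by rewrite linearN /= trmx1.
by rewrite mulmxN mulNmx mulmx1 opprK.
Qed.

Lemma sphere_delta (i : 'I_2) : sphere (col_mx (delta_mx i 0) 0 : 'cV[R]_(2 + 2)).
Proof.
rewrite /sphere /= dotp_split col_mxKu col_mxKd !dotpE mulmx0 [X in _ + X]mxE addr0.
by rewrite trmx_delta mul_delta_mx mxE !eqxx.
Qed.

(** Averaging [K] and [- K], which give the same value, the inequality is the
    triangle inequality; at a point [(x, 0)] with [K x <> 0] it is strict. *)
Lemma map_average_shear_lt K L : K != 0 ->
  map_average (row_mx 0 L) < map_average (row_mx K L).
Proof.
move=> K0; have [j Kj] : exists j, col j K != 0.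
  apply/existsP; apply: contraNT K0 => /existsPn K0; apply/eqP/matrixP => i j.
  have /eqP/(congr1 (fun v : 'cV[R]_2 => v i 0)) := negbNE (K0 j).
  by rewrite !mxE.
rewrite -(@ltr_pM2l _ 2) // -averageZ; last exact: cM.
rewrite [ltRHS]mulr_natl [ltRHS]mulr2n -{2}map_average_row_mxN -averageD; [|exact: cM..].
apply: (lt_average sigma_inv sphere_transitive (p := col_mx (delta_mx j 0) 0)).
- by apply: continuous_scale; exact: cM.
- by apply: continuous_add; exact: cM.
- move=> u _; apply: le_trans (ler_enormD _ _).
  rewrite -mulmxDl add_row_mx subrr -{1}[2]ger0_norm // -enormZ scalemxAl.
  by rewrite scale_row_mx scaler0 scaler_nat mulr2n.
- exact: sphere_delta.
rewrite !mul_row_col !mulmx0 !addr0 mul0mx enorm0 mulr0 mulNmx enormN -colE.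
by rewrite addr_gt0 ?enorm_gt0.
Qed.

Lemma enorm_diag_le d (e : 'rV[R]_2) (x : 'cV[R]_2) :
  (forall i, 0 <= d 0 i <= e 0 i) ->
  enorm (diag_mx d *m x) <= enorm (diag_mx e *m x).
Proof.
move=> de; rewrite ler_wsqrtr // !mul_diag_mx; apply: ler_sum => i _.
have /andP [d0 dei] := de i; rewrite !mxE.
rewrite -!expr2 !exprMn ler_wpM2r ?sqr_ge0 // ler_pXn2r ?nnegrE //.
exact: le_trans dei.
Qed.

Definition dilation_width d : R :=
  map_average (row_mx (diag_mx d) 0) +
  map_average (row_mx 0 (diag_mx (map_mx GRing.inv d))).

(** The first term is convex in [d] as a norm is; for the second, the entries
    [1 / d] are convex functions of [d], and the norm of a diagonal image is
    monotone in nonnegative diagonal entries. *)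
Lemma dilation_width_convex t d : 0 <= t -> t <= 1 -> (forall i, 0 < d 0 i) ->
  dilation_width (t *: d + (1 - t) *: const_mx 1) <=
  t * dilation_width d + (1 - t) * dilation_width (const_mx 1).
Proof.
move=> t0 t1 d0; have t1' : 0 <= 1 - t by rewrite subr_ge0.
rewrite /dilation_width !mulrDr addrACA; apply: lerD.
  rewrite linearD /= !linearZ /=.
  apply: le_trans (map_average_convex _ _ t0 t1).
  by rewrite !scale_row_mx add_row_mx !scaler0 addr0.
apply: le_trans (map_average_convex _ _ t0 t1).
apply: le_average => [||u _]; [exact: cM..|].
rewrite !scale_row_mx add_row_mx !scaler0 addr0 -!linearZ -linearD /=.
rewrite -[u]vsubmxK !mul_row_col !mul0mx !add0r.
apply: enorm_diag_le => i; rewrite !mxE invr1 !mulr1.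
have di := d0 i; set a := d 0 i in di *.
have at0 : 0 < t * a + (1 - t).
  have [->|tn0] := eqVneq t 0; first by rewrite mul0r subr0 add0r.
  by rewrite ltr_pwDl // mulr_gt0 // lt_def tn0.
rewrite invr_ge0 ltW //= -[leLHS]mul1r ler_pdivrMr //.
have -> : (t / a + (1 - t)) * (t * a + (1 - t)) =
    1 + t * (1 - t) * ((a - 1) ^+ 2 / a).
  by field; rewrite gt_eqF.
rewrite lerDl; apply: mulr_ge0; [exact: mulr_ge0 | by rewrite divr_ge0 ?sqr_ge0 ?ltW].
Qed.

(** Once both terms are brought to the same plane by a rotation, this is the
    inequality [2 |x| <= |D x| + |D^-1 x|] between arithmetic and geometric
    means; on a basis vector with [d <> 1] it reads [2 < d + d^-1]. *)
Lemma dilation_width_min d : (forall i, 0 < d 0 i) -> d != const_mx 1 ->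
  dilation_width (const_mx 1) < dilation_width d.
Proof.
move=> d0 d1; have [i di] : exists i, d 0 i != 1.
  apply/existsP; apply: contraNT d1 => /existsPn d1.
  by apply/eqP/matrixP => i j; rewrite (ord1 i) mxE; apply/eqP/negbNE/d1.
have V1 : map_mx GRing.inv (const_mx 1 : 'rV[R]_2) = const_mx 1.
  by apply/matrixP => ? ?; rewrite !mxE invr1.
rewrite /dilation_width !map_average_row_mx0 V1 -!averageD; [|exact: cM..].
rewrite diag_const_mx.
have E (u : 'cV[R]_(2 + 2)) K : row_mx K 0 *m u = K *m usubmx u.
  by rewrite -{1}[u]vsubmxK mul_row_col mul0mx addr0.
apply: (lt_average sigma_inv sphere_transitive (p := col_mx (delta_mx i 0) 0)).
- by apply: continuous_add; exact: cM.
- by apply: continuous_add; exact: cM.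
- move=> u _; rewrite !E mul1mx; set x := usubmx u.
  set a := enorm (diag_mx d *m x); set b := enorm (_ *m x).
  have : enorm x ^+ 2 <= a * b.
    apply: le_trans (dotp_le _ _).
    by rewrite sqr_enorm dotp_mulmxl tr_diag_mx mulmxA diag_mxV // mul1mx.
  have a0 : 0 <= a := enorm_ge0 _; have b0 : 0 <= b := enorm_ge0 _.
  move=> n_ab; rewrite -(@ler_pXn2r _ 2) ?nnegrE ?addr_ge0 ?enorm_ge0 //.
  have := sqr_ge0 (a - b); nra.
- exact: sphere_delta.
rewrite !E col_mxKu mul1mx.
have ed (e : 'rV[R]_2) : diag_mx e *m delta_mx i 0 = e 0 i *: delta_mx i 0 :> 'cV_2.
  apply/matrixP => k l; rewrite mul_diag_mx !mxE.
  by case: eqVneq => [->|] //=; rewrite !mulr0.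
have e1 : enorm (delta_mx i 0 : 'cV[R]_2) = 1.
  by rewrite /enorm dotpE trmx_delta mul_delta_mx mxE !eqxx sqrtr1.
rewrite !ed !enormZ e1 !mulr1 mxE normfV gtr0_norm //.
have d_gt0 := d0 i; rewrite -subr_gt0.
have -> : d 0 i + (d 0 i)^-1 - (1 + 1) = (d 0 i - 1) ^+ 2 / d 0 i.
  by field; rewrite gt_eqF.
by rewrite divr_gt0 // lt_def sqr_ge0 andbT sqrf_eq0 subr_eq0.
Qed.

End PlaneAverage.

(** * Local minima of the width on Sp(4) *)
Section Paths.
Context {R : realType}.

(** Continuity of the path is only required at its end point, where it runs
    into the candidate minimum from lower values. *)
Lemma not_local_min_path {T : topologicalType} (A : set T) (F : T -> R)
    (path : R -> T) :
  {for 1, continuous path} ->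
  (forall t, 0 <= t -> t < 1 -> A (path t) /\ F (path t) < F (path 1)) ->
  ~ local_min_on A F (path 1).
Proof.
move=> cpath descent [_ /cpath /nbhs_ballP [e /= e0 ball_e]].
have m0 : 0 < Num.min e 1 by rewrite lt_min e0 ltr01.
have [me m1] : Num.min e 1 <= e /\ Num.min e 1 <= 1.
  by split; rewrite ge_min lexx ?orbT.
set m := Num.min e 1 in m0 me m1.
have [] := descent (1 - m / 2); [lra | lra |].
move=> Apath; rewrite ltNge => /negP; apply.
apply: ball_e => //; rewrite /ball /= opprB addrC subrK gtr0_norm; lra.
Qed.

Lemma local_min_on_scale {T : topologicalType} (A : set T) (c : R) (F : T -> R) p :
  0 < c -> local_min_on A (fun q => c * F q) p -> local_min_on A F p.
Proof.
move=> c0 [Ap pmin]; split=> //; apply: filterS pmin => q.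
by rewrite ler_pM2l.
Qed.

Lemma dilation_shear_continuous (d : R -> 'rV[R]_2) (S : R -> 'M[R]_2) x :
  (forall i, d x 0 i != 0) -> {for x, continuous d} -> {for x, continuous S} ->
  {for x, continuous (fun t => dilation_shear (d t) (S t))}.
Proof.
move=> dx0 cd cS.
have cdi i : {for x, continuous (fun t => d t 0 i)}.
  exact: (continuous_comp cd (@coord_continuous _ _ _ 0 i _)).
have cSij i j : {for x, continuous (fun t => S t i j)}.
  exact: (continuous_comp cS (@coord_continuous _ _ _ i j _)).
have ext (f g : R -> R) : f =1 g -> {for x, continuous g} -> {for x, continuous f}.
  by move=> /funext ->.
apply: continuous_mx_at => i j; rewrite -(fintype.splitK i) -(fintype.splitK j).
case: (fintype.split i) => i' /=; case: (fintype.split j) => j' /=.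
- apply: (ext _ (fun t => d t 0 i' *+ (i' == j'))) => [t|].
    by rewrite /dilation_shear block_mxEul mxE.
  by case: eqVneq => _; [exact: cdi | exact: cst_continuous].
- apply: (ext _ (fun t => d t 0 i' * S t i' j')) => [t|].
    by rewrite /dilation_shear block_mxEur mul_diag_mx mxE.
  by apply: cvgM; [exact: cdi | exact: cSij].
- apply: (ext _ (fun=> 0)) => [t|]; last exact: cst_continuous.
  by rewrite /dilation_shear block_mxEdl mxE.
- apply: (ext _ (fun t => (d t 0 i')^-1 *+ (i' == j'))) => [t|].
    by rewrite /dilation_shear block_mxEdr !mxE.
  case: eqVneq => _; last exact: cst_continuous.
  by apply: cvgV; [exact: dx0 | exact: cdi].
Qed.

Lemma dilation_shear1 : dilation_shear (const_mx 1) 0 = 1%:M :> 'M[R]_(2 + 2).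
Proof.
rewrite /dilation_shear mulmx0.
have -> : map_mx GRing.inv (const_mx 1 : 'rV[R]_2) = const_mx 1.
  by apply/matrixP => ? ?; rewrite !mxE invr1.
by rewrite diag_const_mx -scalar_mx_block.
Qed.

End Paths.

Section BidiskWidth.
Context {R : realType}.
Variable sigma : probability (borel_space R (2 + 2)) R.
Hypothesis sigma_inv : rotation_invariant_on_sphere sigma.
Implicit Types (P U : 'M[R]_(2 + 2)) (S W : 'M[R]_2) (d : 'rV[R]_2).

Definition bidisk_width P : R :=
  average sigma (fun u => bidisk_support (P^T *m u)).

Lemma bidisk_width_U2l U P : U2 U -> bidisk_width (U *m P) = bidisk_width P.
Proof.
move=> uU; have rU := U2_rotation (U2_trmx uU).
rewrite /bidisk_width -[RHS](average_rotation sigma_inv rU); last first.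
  exact: bidisk_support_continuous.
by apply: eq_average => u _; rewrite trmx_mul mulmxA.
Qed.

Lemma bidisk_width_O2r W P : orthogonal_mx W ->
  bidisk_width (P *m block_mx W 0 0 W) = bidisk_width P.
Proof.
move=> /orthogonal_trmx oW; apply: eq_average => u _.
rewrite trmx_mul tr_block_mx !trmx0 -mulmxA -[P^T *m u]vsubmxK mul_block_col.
rewrite !mul0mx addr0 add0r /bidisk_support !col_mxKu !col_mxKd.
by rewrite !enorm_orthogonal.
Qed.

Lemma bidisk_width_dilation_shear d S :
  bidisk_width (dilation_shear d S) =
  map_average sigma (row_mx (diag_mx d) 0) +
  map_average sigma (row_mx (S^T *m diag_mx d) (diag_mx (map_mx GRing.inv d))).
Proof.
rewrite /bidisk_width /dilation_shear tr_block_mx !tr_diag_mx trmx0 trmx_mul.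
by rewrite tr_diag_mx average_bidisk_support block_mxEv col_mxKu col_mxKd.
Qed.

Lemma bidisk_width_dilation d :
  bidisk_width (dilation_shear d 0) = dilation_width sigma d.
Proof. by rewrite bidisk_width_dilation_shear trmx0 mul0mx. Qed.

Lemma bidisk_width_shear_convex d S t : 0 <= t -> t <= 1 ->
  bidisk_width (dilation_shear d (t *: S)) <=
  t * bidisk_width (dilation_shear d S) +
  (1 - t) * bidisk_width (dilation_shear d 0).
Proof.
move=> t0 t1; rewrite !bidisk_width_dilation_shear trmx0 mul0mx.
set D := map_average _ _; set K := diag_mx (map_mx _ _).
have := map_average_convex sigma (row_mx (S^T *m diag_mx d) K) (row_mx 0 K) t0 t1.
rewrite !scale_row_mx add_row_mx scaler0 addr0 -scalerDl addrC subrK scale1r.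
rewrite linearZ /= -scalemxAl => convex.
rewrite !mulrDr addrACA -mulrDl [t + _]addrC subrK mul1r lerD2l.
exact: convex.
Qed.

Lemma bidisk_width_shear_lt d S : (forall i, 0 < d 0 i) -> S != 0 ->
  bidisk_width (dilation_shear d 0) < bidisk_width (dilation_shear d S).
Proof.
move=> d0 S0; rewrite !bidisk_width_dilation_shear trmx0 mul0mx ltrD2l.
apply: map_average_shear_lt => //.
apply: contra_neq S0 => SD0; apply: trmx_inj.
by rewrite trmx0 -[S^T]mulmx1 -(diag_mxV d0) mulmxA SD0 mul0mx.
Qed.

Lemma dilation_width_ge d : (forall i, 0 < d 0 i) ->
  dilation_width sigma (const_mx 1) <= dilation_width sigma d.
Proof.
move=> d0; have [->//|d1] := eqVneq d (const_mx 1).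
exact: ltW (dilation_width_min sigma_inv d0 d1).
Qed.

(** On normal forms, removing the shear and then the dilation can only decrease
    the width. *)
Lemma bidisk_width_min P : Sp4 P -> bidisk_width 1%:M <= bidisk_width P.
Proof.
move=> /normal_form [U [W [d [S [uU oW d0 _ ->]]]]].
rewrite (bidisk_width_O2r _ oW) (bidisk_width_U2l _ uU).
rewrite -dilation_shear1 bidisk_width_dilation.
apply: le_trans (dilation_width_ge d0) _; rewrite -bidisk_width_dilation.
have [->//|S0] := eqVneq S 0; exact: ltW (bidisk_width_shear_lt d0 S0).
Qed.

(** Shrinking the shear linearly, and then the dilation linearly to the
    identity, stays in Sp(4) and strictly decreases the width: by convexity the
    value at time [t] is at most the interpolation between the value at the
    minimum and the value at [P]. *)
Lemma local_min_bidisk_width P : local_min_on (@Sp4 R) bidisk_width P -> U2 P.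
Proof.
move=> Pmin; have [U [W [d [S [uU oW d0 sS PE]]]]] := normal_form Pmin.1.
pose g (e : R -> 'rV[R]_2) (T : R -> 'M[R]_2) (t : R) :=
  U *m dilation_shear (e t) (T t) *m block_mx W 0 0 W.
have uW := U2_diag_block oW.
have widthg e T t :
    bidisk_width (g e T t) = bidisk_width (dilation_shear (e t) (T t)).
  by rewrite (bidisk_width_O2r _ oW) (bidisk_width_U2l _ uU).
have Sp4g (e : R -> 'rV[R]_2) (T : R -> 'M[R]_2) t :
    (forall i, 0 < e t 0 i) -> (T t)^T = T t -> Sp4 (g e T t).
  move=> e0 sT; apply: Sp4_mul uW.1; apply: Sp4_mul uU.1 _.
  exact/Sp4_dilation_shear.
have cUW : continuous (fun M => U *m M *m block_mx W 0 0 W).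
  apply: mulmx_continuous; first exact: mulmxl_continuous.
  by move=> x; exact: cst_continuous.
have cg (e : R -> 'rV[R]_2) (T : R -> 'M[R]_2) : (forall i, 0 < e 1 0 i) ->
    {for 1, continuous e} -> {for 1, continuous T} ->
    {for 1, continuous (g e T)}.
  move=> e0 ce cT; have e1 i : e 1 0 i != 0 by exact: lt0r_neq0.
  exact: (continuous_comp (dilation_shear_continuous e1 ce cT) (cUW _)).
(* [g] must not be unfolded when path end points are compared *)
have gE e T : P = U *m dilation_shear (e 1) (T 1) *m block_mx W 0 0 W ->
    P = g e T 1 by [].
clearbody g.
have S0 : S = 0.
  apply/eqP; apply: contraPT Pmin => S0.
  pose T (t : R) := t *: S; pose e (t : R) := d.
  have T1 : T 1 = S := scale1r S.
  have ce : continuous e by move=> t; exact: cst_continuous.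
  have cT : continuous T.
    by apply: continuous_mx => i j; under eq_fun do rewrite mxE;
      move=> t; apply: cvgM; [exact: cvg_id | exact: cst_continuous].
  rewrite (gE e T); last by rewrite T1.
  apply: (@not_local_min_path _ _ _ _ (g e T));
    first exact: (cg _ _ d0 (ce 1) (cT 1)).
  move=> t t0 t1; split.
    by apply: (Sp4g e T t d0); rewrite /T linearZ /= sS.
  rewrite !widthg T1.
  apply: le_lt_trans (bidisk_width_shear_convex _ _ t0 (ltW t1)) _.
  have := bidisk_width_shear_lt d0 S0.
  move: (bidisk_width _) (bidisk_width _) => a b ab; nra.
have d1 : d = const_mx 1.
  apply/eqP; apply: contraPT Pmin => d1.
  pose e t := t *: d + (1 - t) *: const_mx 1 : 'rV[R]_2.
  pose T (t : R) : 'M[R]_2 := 0.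
  have cT : continuous T by move=> t; exact: cst_continuous.
  have e1 : e 1 = d by rewrite /e subrr scale0r addr0 scale1r.
  have ce : continuous e.
    apply: continuous_mx => i j; under eq_fun do rewrite !mxE.
    move=> t; apply: cvgD; apply: cvgM;
      do ?[exact: cvg_id | exact: cst_continuous].
    by apply: cvgB; [exact: cst_continuous | exact: cvg_id].
  have e1_gt0 i : 0 < e 1 0 i by rewrite e1.
  rewrite (gE e T); last by rewrite e1 [LHS]PE S0.
  apply: (@not_local_min_path _ _ _ _ (g e T));
    first exact: (cg e T e1_gt0 (ce 1) (cT 1)).
  move=> t t0 t1; split.
    apply: (Sp4g e T t) => [i|]; last by rewrite trmx0.
    rewrite !mxE mulr1; apply: ltr_wpDl; last by rewrite subr_gt0.
    exact: mulr_ge0 t0 (ltW (d0 i)).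
  rewrite !widthg e1 !bidisk_width_dilation.
  apply: le_lt_trans (dilation_width_convex sigma t0 (ltW t1) d0) _.
  have := dilation_width_min sigma_inv d0 d1.
  move: (dilation_width _ _) (dilation_width _ _) => a b ab; nra.
by rewrite PE S0 d1 dilation_shear1 mulmx1; exact: U2_mul uU uW.
Qed.

End BidiskWidth.

(** * The bidisk is not unitarily toric *)
Section NotToric.
Context {R : realType}.

(** The diagonal torus acts by [cos a - sin a * Omega], which commutes with
    unitary matrices.  It takes the point [(1, 0, 1, 0)] of the bidisk to a point
    whose second block has norm [cos a + sin a > 1] for [a = 1 / 2]. *)
Lemma bidisk_not_toric (K : set 'cV[R]_(2 + 2)) (Q : 'M[R]_(2 + 2)) :
  toric K -> U2 Q -> @lagrangian_bidisk R <> image_mx Q K.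
Proof.
move=> torK uQ PLK; pose a : R := 2^-1; pose th : 'I_2 -> R := fun=> a.
have torE v : torus_act th v = cos a *: v - sin a *: (omega_mx R *m v).
  rewrite /torus_act -[in RHS](vsubmxK v) /omega_mx mul_block_col.
  rewrite !mul0mx mulNmx !mul1mx addr0 add0r !scale_col_mx opp_col_mx add_col_mx.
  by congr col_mx; apply/matrixP => i j; rewrite (ord1 j) !mxE; ring.
pose e : 'cV[R]_2 := delta_mx 0 0; pose v := col_mx e e.
have ee : enorm e = 1.
  by rewrite /enorm dotpE trmx_delta mul_delta_mx mxE !eqxx sqrtr1.
have : image_mx Q K v.
  by rewrite -PLK; apply/lagrangian_bidiskE; rewrite col_mxKu col_mxKd ee.
move=> [w Kw Qw].
have : image_mx Q K (Q *m torus_act th w).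
  by exists (torus_act th w) => //; rewrite -(torK th); exists w.
rewrite -PLK => /lagrangian_bidiskE [_]; apply/negP; rewrite -ltNge.
rewrite torE mulmxBr -!scalemxAr mulmxA -U2_omegaC // -mulmxA Qw.
rewrite /v /omega_mx mul_block_col !mul0mx mulNmx !mul1mx addr0 add0r.
rewrite !scale_col_mx opp_col_mx add_col_mx col_mxKd scalerN opprK -scalerDl.
have a2 : a + a = 1 by rewrite /a; lra.
have pi2 : 1 <= pi / 2 :> R by have := @pi_ge2 R; lra.
have c0 : 0 < cos a :> R by apply: cos_gt0_pihalf; apply/andP; split; lra.
have s0 : 0 < sin a :> R by apply: sin_gt0_pihalf; apply/andP; split; lra.
rewrite enormZ ee mulr1 gtr0_norm ?addr_gt0 //.
have := @cos2Dsin2 R a; nra.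
Qed.

End NotToric.

Theorem proposition1p12 (R : realType) :
  (forall sigma : probability (borel_space R (2 + 2)) R,
     rotation_invariant_on_sphere sigma ->
     isolated_local_min_mod (@U2 R) (@Sp4 R)
       (fun P : 'M[R]_(2 + 2) =>
          mean_width sigma (image_mx P (@lagrangian_bidisk R)))
       1%:M) /\
  (forall (K : set 'cV[R]_(2 + 2)) (Q : 'M[R]_(2 + 2)),
     convex_body K -> toric K -> @U2 R Q ->
     @lagrangian_bidisk R <> image_mx Q K).
Proof.
split=> [sigma sigma_inv|K Q _]; last exact: bidisk_not_toric.
have -> : (fun P : 'M[R]_(2 + 2) =>
    mean_width sigma (image_mx P (@lagrangian_bidisk R))) =
    (fun P => 2 * bidisk_width sigma P).
  by apply/funext => P; exact: mean_width_bidisk.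
split.
  split; first by rewrite /Sp4 /= trmx1 mul1mx mulmx1.
  rewrite near_withinE; apply: nearW => P sP; rewrite ler_pM2l; last exact: ltr0n.
  exact: bidisk_width_min.
apply: (@filterE _ (nbhs (1%:M : 'M[R]_(2 + 2)))) => P Pmin.
exists P; last by rewrite mulmx1.
apply: (local_min_bidisk_width sigma_inv).
exact: (local_min_on_scale (ltr0n _ 2)) Pmin.
Qed.
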